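(* For every $\beta\in(0,1)$ there exists a compact set $A_\beta\subset[0,1]$ with $\dim_P A_\beta=\beta$ with the following property: if $f\colon A_\beta\to\mathbb{R}^d$ is an $\alpha$-Hölder continuous function for some $d\in\mathbb{N}^+$ and $\alpha\in(0,1)$, then $$\dim_P f^*(A_\beta)\le \max\left\{\frac{\beta d}{\alpha d+\beta(1-\alpha d)},\ \beta(d+1-\alpha d)\right\}.$$
   Context: $\dim_P$ denotes packing dimension. $f^*(t)=(t,f(t))$, so $f^*(A_\beta)$ is the graph of $f$. $f$ is $\alpha$-Hölder continuous if there is $C<\infty$ with $|f(x)-f(y)|\le C|x-y|^\alpha$ for all $x,y\in A_\beta$. *)

(* Defs.v *)
From HB Require Import structures.
From mathcomp Require Import all_boot all_order all_algebra.
From mathcomp Require Import all_classical all_reals all_analysis.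
Set Implicit Arguments. Unset Strict Implicit. Unset Printing Implicit Defensive.
Import Order.TTheory GRing.Theory Num.Theory.
Import numFieldNormedType.Exports.
Local Open Scope classical_set_scope.
Local Open Scope ring_scope.

Section Dims.
Variables (R : realType) (T : pseudoMetricType R).

(* N_delta(A): least number of balls of radius delta (centred anywhere in T)
   covering A; +oo if no finite cover exists. *)
Definition covnum (A : set T) (delta : R) : \bar R :=
  ereal_inf [set (n%:R)%:E | n in [set n : nat | exists s : seq T,
      size s = n /\ A `<=` \bigcup_(x in [set` s]) ball x delta]].

Definition box_ratio (A : set T) (delta : R) : \bar R :=
  match covnum A delta with
  | EFin r => (ln r / - ln delta)%:E
  | EPInf => +oo%E
  | ENInf => -oo%E
  end.

Definition upper_box_dim (A : set T) : \bar R :=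
  ereal_inf [set ereal_sup [set box_ratio A delta | delta in
                               [set delta | 0 < delta < eps]]
            | eps in [set eps | 0 < eps < 1]].

(* packing dimension, as the modified upper box dimension:
   dim_P A = inf { sup_i dimB_up (A_i) : A ⊆ ⋃_i A_i } *)
Definition packing_dim (A : set T) : \bar R :=
  ereal_inf [set ereal_sup (range (fun i => upper_box_dim (F i)))
            | F in [set F : nat -> set T | A `<=` \bigcup_i F i]].
End Dims.

Definition holder_on (R : realType) (V : normedModType R) (A : set R)
    (f : R -> V) (alpha : R) : Prop :=
  exists C : R, forall x y, A x -> A y -> `|f x - f y| <= C * (`|x - y| `^ alpha).

Definition graph_of (R : realType) (V : Type) (A : set R) (f : R -> V)
  : set (R * V) := [set (t, f t) | t in A].

(* Main.v *)
(* The set is a homogeneous Cantor set whose branching happens in isolated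
   blocks.  For a rapidly growing sequence S_k, every piece of generation k - 1
   contains about exp(beta S_k) equally spaced pieces at mutual distance
   exp(- S_k), so it is solid between the scales exp(- (1 - beta) S_k) and
   exp(- S_k), and looks like a finite set until the scale
   exp(- (1 - beta) S_(k+1)).  The number of pieces of earlier generations is
   exp(o(S_k)).

   To cover the graph at scale exp(- s), with s / alpha between (1 - beta) S_k
   and (1 - beta) S_(k+1), one can use one piece of the graph, up to constants,
   per point of generation k, which costs exp(beta S_k), or cut the set into
   intervals of length exp(- v) and cover the graph above each of them by
   exp(d (s - alpha v)) balls.  Optimising over v gives the two terms of the
   maximum.

   For the lower bound on the packing dimension, a countable family of sets of
   upper box dimension < beta is avoided one set at a time along a nested
   sequence of pieces, as in Baire's theorem. *)

Require Import Defs.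
From HB Require Import structures.
From mathcomp Require Import all_boot all_order all_algebra.
From mathcomp Require Import all_classical all_reals all_analysis.
From mathcomp Require Import ring lra.
Set Implicit Arguments. Unset Strict Implicit. Unset Printing Implicit Defensive.
Import Order.TTheory GRing.Theory Num.Theory.
Import numFieldNormedType.Exports.
Local Open Scope classical_set_scope.
Local Open Scope ring_scope.

(** * Box dimension through covers at scale [expR (- s)] *)

Definition ball_cover (R : realType) (T : pseudoMetricType R) (A : set T)
    (delta : R) (s : seq T) :=
  A `<=` \bigcup_(x in [set` s]) ball x delta.

Section BoxDim.
Variables (R : realType) (T : pseudoMetricType R).
Implicit Types (A : set T) (s delta b : R) (L : seq T).

Lemma packing_dim_le_upper_box_dim A :
  (packing_dim A <= upper_box_dim A)%E.
Proof.
apply: ereal_inf_lbound; exists (fun=> A); first by move=> x Ax; exists 0%N.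
apply/eqP; rewrite eq_le; apply/andP; split.
  by apply: ge_ereal_sup => _ [_ _ <-].
by apply: ereal_sup_ubound; exists 0%N.
Qed.

Lemma box_ratio_le A L s b : 0 < s -> (0 < size L)%N ->
  ball_cover A (expR (- s)) L -> ln (size L)%:R <= b * s ->
  (box_ratio A (expR (- s)) <= b%:E)%E.
Proof.
move=> s0 L0 cL lnL.
have cov_le : (covnum A (expR (- s)) <= (size L)%:R%:E)%E.
  by apply: ereal_inf_lbound; exists (size L) => //; exists L.
rewrite /box_ratio; case: (covnum _ _) cov_le => [r||] //; last by move=> _; rewrite leNye.
rewrite !lee_fin expRK opprK => rL.
rewrite ler_pdivrMr //; apply: le_trans lnL.
have [r0|r0] := ltP 0 r; first by rewrite ler_ln ?posrE ?ltr0n.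
(* An empty set has covering number 0, where [ln] takes the value 0; the nonempty [L] keeps the
   right-hand side nonnegative. *)
by rewrite (ln0 r0) ln_ge0 // ler1n.
Qed.

(** The slack [eta] lets covers be counted up to constants and factors exp(o(s)). *)
Lemma upper_box_dim_le A b :
  (forall eta, 0 < eta -> exists s0, forall s, s0 < s -> exists L,
    [/\ (0 < size L)%N, ball_cover A (expR (- s)) L &
        ln (size L)%:R <= (b + eta) * s]) ->
  (upper_box_dim A <= b%:E)%E.
Proof.
move=> cov; apply/lee_addgt0Pr => eta eta0.
have [s0 {}cov] := cov _ eta0.
rewrite -EFinD.
pose s1 := Num.max s0 0 + 1.
have s1_gt0 : 0 < s1 by rewrite ltr_pwDr // le_max lexx orbT.
apply: (@le_trans _ _ (ereal_sup [set box_ratio A delta | delta in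
    [set delta | 0 < delta < expR (- s1)]])).
  apply: ereal_inf_lbound; exists (expR (- s1)) => //=.
  by rewrite expR_gt0 expR_lt1 oppr_lt0.
apply: ge_ereal_sup => _ [delta /= /andP[d0 d1] <-].
have lns1 : s1 < - ln delta.
  by rewrite ltrNr -[X in _ < X]expRK ltr_ln ?posrE ?expR_gt0.
have s_gt0 : 0 < - ln delta by exact: lt_trans lns1.
have -> : delta = expR (- - ln delta) by rewrite opprK lnK.
have [|L [L0 cL lnL]] := cov (- ln delta).
  apply: le_lt_trans lns1; rewrite /s1.
  by apply: (le_trans (y := Num.max s0 0)); rewrite ?le_max ?lexx // lerDl.
exact: box_ratio_le lnL.
Qed.

(** The gap between [g] and [b] later beats all constants. The [+ 1] gives strict room above the
    infimum [covnum]. *)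
Lemma upper_box_dim_lt A b : (upper_box_dim A < b%:E)%E ->
  exists2 g, g < b & exists s0, forall s, s0 < s -> exists2 L,
    ball_cover A (expR (- s)) L & (size L)%:R < expR (g * s) + 1.
Proof.
move=> /ereal_inf_lt[_ [eps /= /andP[eps0 eps1] <-] sup_lt].
have [g gb sup_le] : exists2 g, g < b & (ereal_sup [set box_ratio A delta |
    delta in [set delta | 0 < delta < eps]%R] <= g%:E)%E.
  case: ereal_sup sup_lt => [g||] //; first by rewrite lte_fin; exists g.
  by move=> _; exists (b - 1); rewrite ?leNye // gtrBl.
exists g => //; exists (- ln eps) => s lts.
have s_gt0 : 0 < s.
  by apply: lt_trans lts; rewrite oppr_gt0 ln_lt0 // eps0.
have : (box_ratio A (expR (- s)) <= g%:E)%E.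
  apply: le_trans sup_le; apply: ereal_sup_ubound; exists (expR (- s)) => //=.
  by rewrite expR_gt0 -(lnK eps0) ltr_expR ltrNl.
rewrite /box_ratio; case E : (covnum _ _) => [r||] //; last first.
  move: E; rewrite /covnum => /(lb_ereal_infNy_adherent 0)[_ [n _ <-]].
  by rewrite lte_fin ltrn0.
rewrite lee_fin expRK opprK ler_pdivrMr // => lnr.
have : (covnum A (expR (- s)) < (r + 1)%:E)%E by rewrite E lte_fin ltrDl.
move=> /ereal_inf_lt[_ [_ [L [<- cL]] <-]]; rewrite lte_fin => Lr.
exists L => //; apply: lt_le_trans Lr _; rewrite lerD2r.
have [r0|r0] := ltP 0 r; first by rewrite -(lnK r0) ler_expR.
exact: le_trans r0 (expR_ge0 _).
Qed.

End BoxDim.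

(** * Covering the graph of a Hölder function *)

Definition itv_cover (R : realType) (A : set R) (rho : R) (L : seq R) :=
  forall t, A t -> exists2 x, x \in L & x <= t <= x + rho.

Section GraphCover.
Variable R : realType.

Lemma ler_coord_norm d (x : 'rV[R]_d) i : `|x 0 i| <= `|x|.
Proof.
rewrite [leRHS]mx_normrE.
exact: (le_bigmax _ (fun ij => `|x ij.1 ij.2|) (0, i)).
Qed.

(** Above an interval of length [rho], the values of [f] fill at most a sup-norm cube of side 2 C
    rho^alpha, which is cut into cells of side [delta]. The first coordinate costs nothing because
    [rho < delta]. *)
Lemma graph_ball_cover (A : set R) d (f : R -> 'rV[R]_d) (alpha C rho delta : R)
    (L : seq R) :
  0 <= C -> 0 <= alpha -> 0 <= rho < delta ->
  (forall x y, A x -> A y -> `|f x - f y| <= C * `|x - y| `^ alpha) ->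
  itv_cover A rho L ->
  exists2 s : seq (R * 'rV[R]_d), ball_cover (graph_of A f) delta s &
    size s = (size L * (Num.trunc (2 * (C * rho `^ alpha) / delta)).+1 ^ d)%N.
Proof.
move=> C0 a0 /andP[rho0 rd] fC cL.
have d0 : 0 < delta by exact: le_lt_trans rd.
pose H := C * rho `^ alpha.
have H0 : 0 <= H by rewrite mulr_ge0 ?powR_ge0.
pose m := (Num.trunc (2 * H / delta)).+1.
(* Reference point of the interval; the default 0 is harmless, as only intervals that meet [A] are
   used. *)
pose p x : R := xget 0 [set t | A t /\ x <= t <= x + rho].
pose c x (g : {ffun 'I_d -> 'I_m}) : R * 'rV[R]_d :=
  (x, \row_i (f (p x) 0 i - H + (g i)%:R * delta)).
exists [seq c x g | x <- L, g <- enum {ffun 'I_d -> 'I_m}]; last first.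
  by rewrite size_allpairs -cardE card_ffun !card_ord.
move=> _ [t At <-] /=.
have [x xL xt] := cL _ At.
have [Ap xp] : A (p x) /\ x <= p x <= x + rho.
  by rewrite /p; case: xgetP => [_ -> //|/(_ t)[]].
pose j i := Num.trunc ((f t 0 i - f (p x) 0 i + H) / delta).
have fH i : `|f t 0 i - f (p x) 0 i| <= H.
  have -> : f t 0 i - f (p x) 0 i = (f t - f (p x)) 0 i by rewrite !mxE.
  apply: le_trans (ler_coord_norm _ _) _; apply: le_trans (fC _ _ At Ap) _.
  rewrite ler_wpM2l // ge0_ler_powR ?nnegrE // ler_norml.
  by move: xt xp => /andP[? ?] /andP[? ?]; apply/andP; split; lra.
have jP i : (j i)%:R * delta <= f t 0 i - f (p x) 0 i + H < (j i)%:R * delta + delta.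
  have /andP[] : (j i)%:R <= (f t 0 i - f (p x) 0 i + H) / delta < (j i).+1%:R.
    by apply/truncn_itv; rewrite divr_ge0 // ?(ltW d0) //; move: (fH i);
      rewrite ler_norml => /andP[? ?]; lra.
  rewrite ler_pdivlMr // ltr_pdivrMr // -natr1 mulrDl mul1r => -> -> //.
have jm i : (j i < m)%N.
  rewrite ltnS le_truncn // ler_pM2r ?invr_gt0 //.
  by move: (fH i); rewrite ler_norml => /andP[? ?]; lra.
exists (c x [ffun i => Ordinal (jm i)]).
  by apply/allpairsP; exists (x, [ffun i => Ordinal (jm i)]); rewrite mem_enum.
split => /=.
  rewrite /ball /= ltr_norml; move: xt => /andP[? ?]; apply/andP; split; lra.
split=> // i0 i; rewrite ord1 !mxE ffunE /= /ball /= ltr_norml.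
by move: (jP i) => /andP[? ?]; apply/andP; split; lra.
Qed.

End GraphCover.

(* The two terms of the maximum are the values of [beta * S / s] at which the
   two covering exponents agree, for [v = (1 - beta) * S] and for [v = s]
   respectively. *)
Lemma cover_tradeoff (R : realType) (alpha beta d S s : R) :
  0 < alpha <= 1 -> 0 < beta < 1 -> 0 < d -> 0 < S ->
  alpha * ((1 - beta) * S) <= s ->
  let D := Num.max (beta * d / (alpha * d + beta * (1 - alpha * d)))
                   (beta * (d + 1 - alpha * d)) in
  beta * S <= D * s \/
  exists v, [/\ s <= v, (1 - beta) * S <= v, alpha * v <= s &
                v - (1 - beta) * S + d * (s - alpha * v) <= D * s].
Proof.
move=> /andP[a0 a1] /andP[b0 b1] d0 S0 ts D.
set q := alpha * d + beta * (1 - alpha * d).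
have ad0 : 0 < alpha * d by rewrite mulr_gt0.
have b1' : 0 < 1 - beta by rewrite subr_gt0.
have q0 : 0 < q.
  have -> : q = alpha * d * (1 - beta) + beta by rewrite /q; ring.
  by rewrite addr_gt0 // mulr_gt0.
have t0 : 0 < (1 - beta) * S by rewrite mulr_gt0.
have s0 : 0 < s by apply: lt_le_trans ts; rewrite mulr_gt0.
have D1 : beta * d <= D * q by rewrite -ler_pdivrMr // le_max lexx.
have D2 : beta * (d + 1 - alpha * d) <= D by rewrite le_max lexx orbT.
have Ds2 := ler_wpM2r (ltW s0) D2.
have D0 : 0 < D.
  by apply: lt_le_trans (_ : beta * d / q <= D); rewrite ?divr_gt0 ?mulr_gt0 // le_max lexx.
have [DbS|DbS] := leP (beta * S) (D * s); [by left|right].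
(* The cost has slope [1 - alpha * d] in [v]. If this is at most 0, take the largest admissible [v],
   namely [s / alpha]. *)
have [ad1|ad1] := leP 1 (alpha * d).
  have Da : beta <= D * alpha.
    rewrite -(ler_pM2r d0); apply: le_trans D1 _; rewrite -mulrA ler_pM2l //.
    have -> : q = alpha * d - beta * (alpha * d - 1) by rewrite /q; ring.
    by rewrite gerBl mulr_ge0 ?(ltW b0) // subr_ge0.
  have saS : s < alpha * S.
    rewrite -(ltr_pM2l b0); apply: le_lt_trans (_ : D * alpha * s < _).
      by rewrite ler_pM2r.
    have -> : D * alpha * s = alpha * (D * s) by ring.
    have -> : beta * (alpha * S) = alpha * (beta * S) by ring.
    by rewrite ltr_pM2l.
  have asa : alpha * (s / alpha) = s by rewrite mulrC divfK // gt_eqF.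
  exists (s / alpha); rewrite asa subrr mulr0 addr0; split => //.
  - by rewrite ler_pdivlMr // ler_piMr // ltW.
  - by rewrite ler_pdivlMr // mulrC.
  - rewrite lerBlDr ler_pdivrMr //.
    have Das := ler_wpM2r (ltW s0) Da.
    have := ler_wpM2l (ltW b1') (ltW saS).
    lra.
(* The slope is now positive: take the least admissible [v], the larger of [s] and
   [(1 - beta) * S]. *)
have [st|ts'] := ltP s ((1 - beta) * S).
  exists ((1 - beta) * S); split=> //; first exact: ltW.
  rewrite subrr add0r leNgt; apply/negP => DdS.
  (* The weights make [S] cancel in the sum of [H1] and [H2], which contradicts [D1]; the case
     [v = s] contradicts [D2] in the same way. *)
  have /= H1 : 0 < alpha * d * (1 - beta) * (beta * S - D * s).
    by rewrite !mulr_gt0 ?subr_gt0.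
  have /= H2 : 0 < beta * (d * (s - alpha * ((1 - beta) * S)) - D * s).
    by rewrite mulr_gt0 ?subr_gt0.
  have := ler_wpM2r (ltW s0) D1; rewrite /q; lra.
exists s; split=> //; first by rewrite ler_piMl // ltW.
rewrite leNgt; apply/negP => DdS.
have H1 : 0 < (1 - beta) * (beta * S - D * s) by rewrite mulr_gt0 ?subr_gt0.
have H2 : 0 < beta * (s - (1 - beta) * S + d * (s - alpha * s) - D * s).
  by rewrite mulr_gt0 ?subr_gt0.
lra.
Qed.

(** * Construction of the Cantor set *)

Section CantorSet.
Variables (R : realType) (beta : R).
Hypothesis beta01 : 0 < beta < 1.

Let b0 : 0 < beta. Proof. by case/andP: beta01. Qed.
Let b1 : 0 < 1 - beta. Proof. by case/andP: beta01; rewrite subr_gt0. Qed.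

Definition growth : nat := (Num.trunc (3 / (1 - beta))).+1.
(** The S_k of the overview. The ratios [growth * k.+1] are unbounded, so earlier generations become
    negligible; [growth] makes even the first ratios large against [1 / (1 - beta)]. *)
Definition level k : nat := growth ^ k * k`!.
Definition mesh k : R := expR (- (level k)%:R).
Definition branching k : nat := Num.trunc (expR (beta * (level k)%:R)).
(** The index shifts: a piece of generation [k] is only as long as the row of its children, about
    exp(-(1 - beta) S_(k+1)). *)
Definition width k : R := (branching k.+1)%:R * mesh k.+1.

Fixpoint nodes k : seq R :=
  if k is k'.+1 then
    [seq y + j%:R * mesh k | y <- nodes k', j <- iota 0 (branching k)]
  else [:: 0].

(** The witnesses [y] need not be nested; [nodes_restrict] supplies the nesting. *)
Definition cantor : set R :=
  [set x | forall k, exists2 y, y \in nodes k & y <= x <= y + width k].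

(** * Estimates on levels, widths and numbers of nodes *)

Lemma growth_ge : 3 <= growth%:R * (1 - beta).
Proof.
rewrite -ler_pdivrMr //; apply: ltW.
by have /andP[] : (Num.trunc (3 / (1 - beta)))%:R <= 3 / (1 - beta) < growth%:R
  by apply: truncn_itv; rewrite divr_ge0 // ltW.
Qed.

Lemma level_gt0 k : (0 < level k)%N.
Proof. by rewrite muln_gt0 expn_gt0 fact_gt0. Qed.

Lemma levelS k : level k.+1 = (growth * k.+1 * level k)%N.
Proof. by rewrite /level expnS factS; ring. Qed.

Lemma level_ge1 k : 1 <= (level k)%:R :> R.
Proof. by rewrite ler1n level_gt0. Qed.

(** The 3 separates the pieces; the factor [k.+1] makes errors of order [level k] negligible at the
    scales governed by [level k.+1]. *)
Lemma levelS_ge k : 3 * k.+1%:R * (level k)%:R <= (1 - beta) * (level k.+1)%:R.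
Proof.
rewrite levelS 2!natrM.
have -> : (1 - beta) * (growth%:R * k.+1%:R * (level k)%:R) =
  growth%:R * (1 - beta) * (k.+1%:R * (level k)%:R) by ring.
by rewrite -mulrA ler_wpM2r ?mulr_ge0 // growth_ge.
Qed.

Lemma levelS_ge2 k : 2 * (level k)%:R <= (level k.+1)%:R :> R.
Proof.
have h := levelS_ge k.
have k1 : 0 <= k%:R * (level k)%:R :> R by rewrite mulr_ge0.
have b2 : 0 <= beta * (level k.+1)%:R by rewrite mulr_ge0 // ltW.
have := level_ge1 k; rewrite -natr1 in h; lra.
Qed.

Lemma leq_level : {homo level : k l / (k <= l)%N}.
Proof.
apply: homo_leq => [//|k l m|k]; first exact: leq_trans.
by rewrite levelS leq_pmull.
Qed.

Lemma level_ge k : (k <= level k)%N.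
Proof.
elim: k => // k IH; rewrite levelS.
by apply: leq_trans (leq_pmulr _ (level_gt0 k)); rewrite leq_pmull.
Qed.

Lemma branchingP k : (branching k)%:R <= expR (beta * (level k)%:R) < (branching k)%:R + 1.
Proof. by rewrite natr1; apply: truncn_itv; exact: expR_ge0. Qed.

Lemma branching_gt0 k : (0 < branching k)%N.
Proof. by rewrite truncn_gt0 -expR0 ler_expR mulr_ge0 // ltW. Qed.

Lemma width_gt0 k : 0 < width k.
Proof. by rewrite mulr_gt0 ?expR_gt0 // ltr0n branching_gt0. Qed.

Lemma width_le k : width k <= expR (- ((1 - beta) * (level k.+1)%:R)).
Proof.
apply: le_trans (_ : expR (beta * (level k.+1)%:R) * mesh k.+1 <= _).
  by rewrite ler_pM2r ?expR_gt0 //; case/andP: (branchingP k.+1).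
by rewrite -expRD ler_expR; lra.
Qed.

(** Siblings are thus separated by gaps comparable to the mesh, as [avoid_node] requires. *)
Lemma widthS_le k : width k.+1 <= mesh k.+1 * expR (- 2).
Proof.
apply: le_trans (width_le _) _; rewrite -expRD ler_expR.
have h := levelS_ge k.+1; have := level_ge1 k.+1.
have : 0 <= k.+1%:R * (level k.+1)%:R :> R by rewrite mulr_ge0.
rewrite -natr1 in h; lra.
Qed.

Lemma expRN2_le : expR (- 2) <= 1 / 4 :> R.
Proof.
have -> : - 2 = - 1 + - 1 :> R by ring.
rewrite expRD expRN.
have e2 : 2 <= expR 1 :> R by apply: le_trans (expR_ge1Dx 1); lra.
have e0 : (expR 1)^-1 <= 2^-1 :> R by rewrite lef_pV2 ?posrE // (lt_le_trans _ e2).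
have e1 : 0 <= (expR 1)^-1 :> R by rewrite invr_ge0 expR_ge0.
by apply: le_trans (ler_pM e1 e1 e0 e0) _; lra.
Qed.

Lemma widthS_le_mesh k : width k.+1 <= mesh k.+1.
Proof.
by apply: le_trans (widthS_le k) _; rewrite ler_piMr ?expR_ge0.
Qed.

Lemma size_nodesS k : size (nodes k.+1) = (size (nodes k) * branching k.+1)%N.
Proof. by rewrite /= size_allpairs size_iota. Qed.

Lemma size_nodes_gt0 k : (0 < size (nodes k))%N.
Proof. by elim: k => // k IH; rewrite size_nodesS muln_gt0 IH branching_gt0. Qed.

Lemma ln_size_nodesS k : ln (size (nodes k.+1))%:R <=
  ln (size (nodes k))%:R + beta * (level k.+1)%:R :> R.
Proof.
rewrite size_nodesS natrM lnM ?posrE ?ltr0n ?size_nodes_gt0 ?branching_gt0 //.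
rewrite lerD2l -[leRHS]expRK ler_ln ?posrE ?expR_gt0 ?ltr0n ?branching_gt0 //.
by case/andP: (branchingP k.+1).
Qed.

(** The levels at least double, so the sum over generations is dominated by a geometric series. *)
Lemma ln_size_nodes k : ln (size (nodes k))%:R <= 2 * (level k)%:R * beta :> R.
Proof.
elim: k => [|k IH]; first by rewrite /= ln1 !mulr_ge0 // ltW.
apply: le_trans (ln_size_nodesS k) _.
have := ler_wpM2r (ltW b0) (levelS_ge2 k); lra.
Qed.

Lemma nodes_child k y j : y \in nodes k -> (j < branching k.+1)%N ->
  y + j%:R * mesh k.+1 \in nodes k.+1.
Proof. by move=> yk jb; apply/allpairsP; exists (y, j); rewrite mem_iota. Qed.

Lemma node_child_width k y j : (j < branching k.+1)%N ->
  y <= y + j%:R * mesh k.+1 /\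
  y + j%:R * mesh k.+1 + width k.+1 <= y + width k.
Proof.
move=> jb; split; first by rewrite lerDl mulr_ge0 ?expR_ge0.
rewrite -addrA lerD2l.
apply: le_trans (_ : j.+1%:R * mesh k.+1 <= _).
  by rewrite -natr1 mulrDl mul1r lerD2l widthS_le_mesh.
by rewrite ler_pM2r ?expR_gt0 // ler_nat.
Qed.

(** The child with [j = 0] has the left endpoint of its parent, so a node persists in later
    generations. *)
Lemma nodes_extend k l y : y \in nodes k -> (k <= l)%N ->
  y \in nodes l /\ width l <= width k.
Proof.
move=> yk; elim: l => [|l IH]; first by rewrite leqn0 => /eqP k0; subst.
rewrite leq_eqVlt => /predU1P[<- //|]; rewrite ltnS => /IH[yl wl].
have := nodes_child yl (branching_gt0 _); rewrite mul0r addr0 => yl1; split=> //.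
apply: le_trans wl; have [_] := node_child_width y (branching_gt0 l.+1).
by rewrite mul0r addr0 lerD2l.
Qed.

(** Pieces lie inside their parents, so membership in [cantor] may be checked on arbitrarily late
    generations. *)
Lemma nodes_restrict k l x : (k <= l)%N ->
  (exists2 y, y \in nodes l & y <= x <= y + width l) ->
  exists2 y, y \in nodes k & y <= x <= y + width k.
Proof.
elim: l => [|l IH]; first by rewrite leqn0 => /eqP ->.
rewrite leq_eqVlt => /predU1P[<- //|]; rewrite ltnS => kl [z /allpairsP[[y j]]].
rewrite mem_iota add0n /= => -[yl jb ->] /andP[yx xy]; apply: IH => //.
have [h1 h2] := node_child_width y jb.
by exists y => //; rewrite (le_trans h1 yx) (le_trans xy h2).
Qed.

(** * Compactness and interval covers *)

Lemma cantor_sub : cantor `<=` `[0, 1]%classic.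
Proof.
move=> x /(_ 0%N)[y]; rewrite inE => /eqP -> /andP[x0 xw].
rewrite /= in_itv /= x0 (le_trans xw) // add0r (le_trans (width_le _)) //.
by rewrite -[leRHS]expR0 ler_expR oppr_le0 mulr_ge0 // ltW.
Qed.

Lemma cantor_compact : compact cantor.
Proof.
apply: (subclosed_compact _ (@segment_compact _ 0 1) cantor_sub).
have -> : cantor = \bigcap_k \bigcup_(y in [set` nodes k])
    [set` `[y, y + width k]].
  apply/seteqP; split => x /= xC k.
    by move=> _; have [y yk yx] := xC k; exists y => //=; rewrite in_itv.
  by have [y yk /=] := xC k I; rewrite in_itv; exists y.
apply: closed_bigI => k _; apply: closed_bigcup => [|y _]; first exact: finite_seq.
exact: itv_closed.
Qed.

Lemma cantor_itv_cover k : itv_cover cantor (width k) (nodes k).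
Proof. by move=> t /(_ k). Qed.

Lemma cantor_fine_cover k rho : 0 < rho ->
  itv_cover cantor rho
    [seq y + j%:R * rho | y <- nodes k, j <- iota 0 (Num.trunc (width k / rho)).+1].
Proof.
move=> rho0 t /(_ k)[y yk /andP[yt ty]].
have := truncn_itv (divr_ge0 (_ : 0 <= t - y) (ltW rho0)); rewrite subr_ge0.
move=> /(_ yt); set j := Num.trunc _ => /andP[].
rewrite ler_pdivlMr // ltr_pdivrMr // -natr1 mulrDl mul1r => j1 j2.
exists (y + j%:R * rho); last by apply/andP; split; lra.
apply/allpairsP; exists (y, j).
rewrite mem_iota add0n ltnS le_truncn //= ler_pM2r ?invr_gt0 //.
by rewrite lerBlDl.
Qed.

(** * Upper bound: logarithmic size of covers of the graph *)

Lemma graph_log_cover d (f : R -> 'rV[R]_d) (alpha C rho s v : R) (L : seq R) :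
  0 <= C -> 0 < alpha ->
  (forall x y, cantor x -> cantor y -> `|f x - f y| <= C * `|x - y| `^ alpha) ->
  (0 < size L)%N -> itv_cover cantor rho L ->
  0 <= rho < expR (- s) -> rho <= expR (- v) -> alpha * v <= s ->
  exists G : seq (R * 'rV[R]_d), [/\ (0 < size G)%N,
    ball_cover (graph_of cantor f) (expR (- s)) G &
    ln (size G)%:R <= ln (size L)%:R + d%:R * (ln (2 * C + 1) + (s - alpha * v))].
Proof.
move=> C0 a0 fC L0 cL rs rv avs.
have [G cG sG] := graph_ball_cover C0 (ltW a0) rs fC cL.
have rho0 : 0 <= rho by case/andP: rs.
move: sG; set m := (Num.trunc _).+1 => sG.
have m0 : (0 < m ^ d)%N by rewrite expn_gt0.
exists G; split=> //; first by rewrite sG muln_gt0 L0.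
rewrite sG natrM lnM ?posrE ?ltr0n // lerD2l natrX lnXn ?ltr0n //.
rewrite -[leLHS]mulr_natl ler_wpM2l //.
have C1 : 0 < 2 * C + 1 by lra.
rewrite -[s - _]expRK -lnM ?posrE ?expR_gt0 // ler_ln ?posrE ?ltr0n //; last first.
  by rewrite mulr_gt0 ?expR_gt0.
(* The [+ 1] from rounding is absorbed into [expR (s - alpha * v)], which is at least 1 as
   [alpha * v <= s]. *)
rewrite -[leLHS]natr1 [leRHS]mulrDl mul1r lerD //; last first.
  by rewrite -expR0 ler_expR subr_ge0.
have H0 : 0 <= 2 * (C * rho `^ alpha) / expR (- s).
  by rewrite divr_ge0 ?expR_ge0 // mulr_ge0 // mulr_ge0 // powR_ge0.
apply: le_trans (_ : 2 * (C * rho `^ alpha) / expR (- s) <= _).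
  by case/andP: (truncn_itv H0).
rewrite -expRN opprK -!mulrA ler_wpM2l // ler_wpM2l // addrC expRD.
rewrite ler_wpM2r ?expR_ge0 //.
have -> : - (alpha * v) = - v * alpha by ring.
by rewrite expRM ge0_ler_powR ?nnegrE ?expR_ge0 // ltW.
Qed.

Lemma scale_between (alpha s : R) k0 : 0 < alpha ->
  alpha * ((1 - beta) * (level k0.+1)%:R) < s ->
  exists k, [/\ (k0 <= k)%N, alpha * ((1 - beta) * (level k.+1)%:R) <= s &
    s < alpha * ((1 - beta) * (level k.+2)%:R)].
Proof.
move=> a0 s0.
have c0 : 0 < alpha * (1 - beta) by rewrite mulr_gt0.
have s_gt0 : 0 < s.
  by apply: le_lt_trans s0; rewrite !mulr_ge0 // ltW.
have ex : exists k, s < alpha * ((1 - beta) * (level k.+2)%:R).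
  exists (Num.trunc (s / (alpha * (1 - beta)))).
  rewrite mulrA mulrC -ltr_pdivrMr //.
  have /andP[_ h] := truncn_itv (divr_ge0 (ltW s_gt0) (ltW c0)).
  apply: lt_le_trans h _; rewrite ler_nat.
  by apply: leq_trans (level_ge _).
case: (ex_minnP ex) => k sk kmin; exists k.
have k0k : (k0 <= k)%N.
  rewrite leqNgt; apply/negP => kk0; move: (lt_trans s0 sk).
  by rewrite !ltr_pM2l // ltr_nat ltnNge leq_level.
(* For [k = 0] minimality gives no lower bound, but then [k0 = 0] and the hypothesis on [s] does. *)
split=> //; case: k sk kmin k0k => [|k] sk kmin k0k.
  by move: k0k s0; rewrite leqn0 => /eqP -> /ltW.
by rewrite leNgt; apply/negP => /kmin; rewrite ltnn.
Qed.

Lemma graph_cantor_log_cover d (f : R -> 'rV[R]_d) (alpha eta : R) :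
  (0 < d)%N -> 0 < alpha <= 1 -> holder_on cantor f alpha -> 0 < eta ->
  exists s0, forall s, s0 < s -> exists G : seq (R * 'rV[R]_d),
    [/\ (0 < size G)%N, ball_cover (graph_of cantor f) (expR (- s)) G &
        ln (size G)%:R <=
          (Num.max (beta * d%:R / (alpha * d%:R + beta * (1 - alpha * d%:R)))
                   (beta * (d%:R + 1 - alpha * d%:R)) + eta) * s].
Proof.
move=> d0 /andP[a0 a1] [C' fC'] eta0.
pose C := `|C'|.
have C0 : 0 <= C by rewrite normr_ge0.
have fC x y : cantor x -> cantor y -> `|f x - f y| <= C * `|x - y| `^ alpha.
  move=> Ax Ay; apply: le_trans (fC' _ _ Ax Ay) _.
  by rewrite ler_wpM2r ?powR_ge0 // ler_norm.
set D := Num.max _ _.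
pose c := ln 3 + d%:R * ln (2 * C + 1).
have ln3 : 0 <= ln 3 :> R by rewrite ln_ge0 //; lra.
have lnC : 0 <= d%:R * ln (2 * C + 1) by rewrite mulr_ge0 // ln_ge0 //; lra.
(* From [k0] on, [k.+1 * eta * alpha] exceeds [2 + c]; with [levelS_ge] this puts the whole error
   below [eta * s]. *)
pose k0 := Num.trunc ((2 + c) / (eta * alpha)).
exists (alpha * ((1 - beta) * (level k0.+1)%:R)) => s s0.
have [k [k0k tks stk]] := scale_between a0 s0.
have lk := level_ge1 k.
have err : 2 * (level k)%:R * beta + c <= eta * s.
  have ea : 0 < eta * alpha by rewrite mulr_gt0.
  have : 0 <= (2 + c) / (eta * alpha) by rewrite divr_ge0 ?(ltW ea) // /c; lra.
  move/truncn_itv => /andP[_]; rewrite -/k0 ltr_pdivrMr // => h1.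
  have h2 : (2 + c) * (level k)%:R <= k.+1%:R * (eta * alpha) * (level k)%:R.
    rewrite ler_wpM2r //; apply: le_trans (ltW h1) _.
    by rewrite ler_wpM2r ?(ltW ea) // ler_nat.
  have h3 : 2 * (level k)%:R * beta + c <= (2 + c) * (level k)%:R.
    have c0 : 0 <= c by rewrite /c; lra.
    rewrite [leRHS]mulrDl lerD ?ler_peMr // ler_piMr ?mulr_ge0 //.
    by case/andP: beta01 => _ /ltW.
  have h4 : eta * (alpha * (3 * k.+1%:R * (level k)%:R)) <= eta * s.
    rewrite ler_pM2l //; apply: le_trans tks; rewrite ler_pM2l //.
    exact: levelS_ge.
  have h5 : 0 <= k.+1%:R * (eta * alpha) * (level k)%:R.
    by rewrite !mulr_ge0 // ltW.
  lra.
have d0' : 0 < d%:R :> R by rewrite ltr0n.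
have S0 : 0 < (level k.+1)%:R :> R by rewrite ltr0n level_gt0.
have a01 : 0 < alpha <= 1 by rewrite a0.
have s_gt0 : 0 < s by apply: lt_le_trans tks; rewrite !mulr_gt0.
(* First case: one interval per node of generation [k.+1], with [s / alpha] for [v] so that the
   vertical cost is constant. Second case: pieces of generation [k] are cut to length about
   [expR (- v)]. *)
have [bS|[v [sv tv avs vD]]] := cover_tradeoff a01 beta01 d0' S0 tks.
  have asa : alpha * (s / alpha) = s by rewrite mulrC divfK // gt_eqF.
  have rsa : width k.+1 <= expR (- (s / alpha)).
    apply: le_trans (width_le _) _; rewrite ler_expR lerN2 ler_pdivrMr //.
    by rewrite mulrC ltW.
  have rs : 0 <= width k.+1 < expR (- s).
    rewrite ltW ?width_gt0 //=; apply: le_lt_trans (width_le _) _.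
    rewrite ltr_expR ltrN2; apply: lt_le_trans stk _.
    by rewrite ler_piMl // mulr_ge0 // ltW.
  have [|G [G0 cG lnG]] := graph_log_cover C0 a0 fC (size_nodes_gt0 k.+1)
    (cantor_itv_cover k.+1) rs rsa; first by rewrite asa.
  exists G; split=> //; apply: le_trans lnG _.
  rewrite asa subrr addr0.
  have := ln_size_nodesS k; have := ln_size_nodes k.
  rewrite -/D in bS; move: err; rewrite /c mulrDl; lra.
(* Halving keeps [rho < expR (- s)] strict even when [v = s]. This factor 2 and the rounding give
   the [ln 3]. *)
pose rho : R := expR (- v) / 2.
have rho0 : 0 < rho by rewrite divr_gt0 ?expR_gt0.
have rhov : rho < expR (- v) by rewrite ltr_pdivrMr // ltr_pMr ?expR_gt0 //; lra.
set L := [seq y + j%:R * rho | y <- nodes k, j <- iota 0 (Num.trunc (width k / rho)).+1].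
have sL : size L = (size (nodes k) * (Num.trunc (width k / rho)).+1)%N.
  by rewrite size_allpairs size_iota.
have L0 : (0 < size L)%N by rewrite sL muln_gt0 size_nodes_gt0.
have rs : 0 <= rho < expR (- s).
  by rewrite (ltW rho0) (lt_le_trans rhov) // ler_expR lerN2.
have [G [G0 cG lnG]] := graph_log_cover C0 a0 fC L0 (cantor_fine_cover k rho0)
  rs (ltW rhov) avs.
have lnL : ln (size L)%:R <= ln (size (nodes k))%:R + (ln 3 + (v - (1 - beta) * (level k.+1)%:R)) :> R.
  rewrite sL natrM lnM ?posrE ?ltr0n ?size_nodes_gt0 // lerD2l.
  rewrite -[v - _]expRK -lnM ?posrE ?expR_gt0 // ler_ln ?posrE ?ltr0n //; last first.
    by rewrite mulr_gt0 ?expR_gt0.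
  have e1 : 1 <= expR (v - (1 - beta) * (level k.+1)%:R).
    by rewrite -[leLHS]expR0 ler_expR subr_ge0.
  have wr : width k / rho <= 2 * expR (v - (1 - beta) * (level k.+1)%:R).
    rewrite ler_pdivrMr // /rho addrC expRD.
    have -> : 2 * (expR (- ((1 - beta) * (level k.+1)%:R)) * expR v) * (expR (- v) / 2) =
      expR (- ((1 - beta) * (level k.+1)%:R)) * (expR v * expR (- v)) by field.
    by rewrite -expRD subrr expR0 mulr1 width_le.
  have /andP[h _] : (Num.trunc (width k / rho))%:R <= width k / rho <
      (Num.trunc (width k / rho)).+1%:R.
    by apply: truncn_itv; rewrite divr_ge0 // ltW // width_gt0.
  rewrite -natr1; lra.
exists G; split=> //; apply: le_trans lnG _.
have := ln_size_nodes k.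
rewrite -/D in vD; move: err; rewrite /c mulrDl; lra.
Qed.

(** For the zero function with [d = 1] and [alpha = 1] both terms of the maximum equal [beta], and
    covers of the graph project to covers of the set. *)
Lemma upper_box_dim_cantor : (upper_box_dim cantor <= beta%:E)%E.
Proof.
have hf : holder_on cantor (fun=> 0 : 'rV[R]_1) 1.
  by exists 0 => x y _ _; rewrite subrr normr0 mul0r.
have a01 : 0 < (1 : R) <= 1 by rewrite ltr01 lexx.
apply: upper_box_dim_le => eta eta0.
have [s0 cov] := graph_cantor_log_cover (ltn0Sn 0) a01 hf eta0.
exists s0 => s /cov[G [G0 cG lnG]]; exists (map fst G); rewrite size_map; split=> //.
  move=> t At; have [|p pG [pt _]] := cG (t, 0); first by exists t.
  by exists p.1 => //=; exact: map_f.
move: lnG; rewrite !mulr1 subrr mulr0 addr0 divr1.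
by rewrite [1 + 1 - 1]addrK mulr1 maxxx.
Qed.

Lemma packing_dim_graph_le d (f : R -> 'rV[R]_d) (alpha : R) :
  (0 < d)%N -> 0 < alpha < 1 -> holder_on cantor f alpha ->
  (packing_dim (graph_of cantor f) <=
    (Num.max (beta * d%:R / (alpha * d%:R + beta * (1 - alpha * d%:R)))
             (beta * (d%:R + 1 - alpha * d%:R)))%:E)%E.
Proof.
move=> d0 /andP[a0 a1] hf; apply: le_trans (packing_dim_le_upper_box_dim _) _.
apply: upper_box_dim_le => eta eta0; apply: graph_cantor_log_cover => //.
by rewrite a0 ltW.
Qed.

(* Distinct children of a node are too far apart to meet a common ball of radius
   [mesh l.+1 * expR (- 2)], so covering them all needs about
   [mesh l.+1 `^ (- beta)] balls, more than [F] allows. *)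
Lemma avoid_node (F : set R) k x : (upper_box_dim F < beta%:E)%E ->
  x \in nodes k -> exists l y, [/\ (k < l)%N, y \in nodes l, x <= y,
    y + width l <= x + width k & forall t, F t -> ~~ (y <= t <= y + width l)].
Proof.
move=> /upper_box_dim_lt[g gb [s0 cov]] xk.
have bg : 0 < beta - g by rewrite subr_gt0.
(* The three thresholds give: a cover by few balls, [g * (S + 2) + 2 <= beta * S], and
   [2 <= beta * S], for S the level of generation [l.+1]. *)
pose T : R := Num.max s0 (Num.max ((2 * `|g| + 2) / (beta - g)) (2 / beta)).
pose l := maxn k (Num.trunc T).
have lT : T < (level l.+1)%:R.
  have T0 : 0 <= T.
    by rewrite !le_max; apply/orP; right; apply/orP; right; rewrite divr_ge0 // ltW.
  have /andP[_ h] := truncn_itv T0; apply: lt_le_trans h _.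
  rewrite ler_nat; apply: leq_trans (level_ge _).
  by rewrite ltnS leq_maxr.
move: lT; rewrite !gt_max => /and3P[ls0]; rewrite !ltr_pdivrMr // => lg lb.
have [|N cN] := cov ((level l.+1)%:R + 2); first by rewrite (lt_trans ls0) // ltrDl.
rewrite opprD expRD -/(mesh l.+1) in cN.
have e3 : 3 <= expR 2 :> R by apply: le_trans (expR_ge1Dx 2); lra.
have NB : expR (g * ((level l.+1)%:R + 2)) + 1 <= (branching l.+1)%:R.
  have /andP[_ /ltW hb] := branchingP l.+1.
  rewrite -(lerD2r 1); apply: le_trans hb.
  have h1 : expR (g * ((level l.+1)%:R + 2)) * 3 <= expR (beta * (level l.+1)%:R).
    apply: le_trans (ler_wpM2l (expR_ge0 _) e3) _; rewrite -expRD ler_expR.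
    have := ler_norm g; lra.
  have h2 : 3 <= expR (beta * (level l.+1)%:R).
    by apply: le_trans e3 _; rewrite ler_expR mulrC ltW.
  lra.
move=> /lt_le_trans/(_ NB); rewrite ltr_nat => {}NB.
have kl : (k <= l)%N by exact: leq_maxl.
have [xl wl] := nodes_extend xk kl.
pose y (j : 'I_(branching l.+1)) : R := x + j%:R * mesh l.+1.
suff [j yj] : exists j, forall t, F t -> ~~ (y j <= t <= y j + width l.+1).
  exists l.+1, (y j); split=> //; first exact: nodes_child.
    by have [] := node_child_width x (ltn_ord j).
  have [_ h] := node_child_width x (ltn_ord j); apply: le_trans h _.
  by rewrite lerD2l.
apply: contrapT => /forallNP hit.
have /choice[c hc] : forall j, exists c : R, c \in N /\
    exists2 t, ball c (mesh l.+1 * expR (- 2)) t & y j <= t <= y j + width l.+1.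
  move=> j.
  have [t ht] : exists t, ~ (F t -> ~~ (y j <= t <= y j + width l.+1)) by exact/existsNP/hit.
  move/not_implyP: ht => [Ft /negP/negPn yt].
  by have [c cN' ct] := cN _ Ft; exists c; split=> //; exists t.
(* Points of a common ball are less than half a mesh apart, and each is within a quarter mesh of the
   left end of its child, so these ends differ by less than one mesh. *)
have c_inj : injective c.
  move=> i j cij; have [_ [t]] := hc i; have [_ [u]] := hc j; rewrite cij.
  rewrite /ball /= => /ltr_normlP[u1 u2] /andP[u3 u4] /ltr_normlP[t1 t2] /andP[t3 t4].
  have w := widthS_le l; have e4 := expRN2_le.
  have m0 : 0 < mesh l.+1 by exact: expR_gt0.
  have me : mesh l.+1 * expR (- 2) <= mesh l.+1 / 4.
    by rewrite ler_pM2l //; apply: le_trans e4 _; lra.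
  rewrite /y in u3 u4 t3 t4.
  have : `|i%:R - j%:R : R| * mesh l.+1 < 1 * mesh l.+1.
    rewrite -[X in _ * X < _](gtr0_norm m0) -normrM ltr_norml mulrBl.
    by apply/andP; split; lra.
  rewrite ltr_pM2r // ltr_norml => /andP[ij1 ij2].
  have ij_lt (m n : nat) : m%:R - n%:R < 1 :> R -> (m <= n)%N.
    by rewrite ltrBlDl natr1 ltr_nat.
  apply/val_inj/eqP; rewrite eqn_leq !ij_lt //; lra.
have : (size (map c (enum 'I_(branching l.+1))) <= size N)%N.
  apply: uniq_leq_size; first by rewrite map_inj_uniq ?enum_uniq.
  by move=> _ /mapP[j _ ->]; have [] := hc j.
by rewrite size_map size_enum_ord leqNgt NB.
Qed.

Lemma packing_dim_cantor_ge : (beta%:E <= packing_dim cantor)%E.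
Proof.
apply: le_ereal_inf_tmp => _ [F cF <-]; rewrite leNgt; apply/negP => supF.
have Fb i : (upper_box_dim (F i) < beta%:E)%E.
  by apply: le_lt_trans supF; apply: ereal_sup_ubound; exists i.
(* A node carries its generation because [avoid_node] may skip generations. *)
pose node := {p : nat * R | p.2 \in nodes p.1}.
pose lo (p : node) := (val p).2; pose hi (p : node) := (val p).2 + width (val p).1.
have /choice[nxt nxtP] : forall ip : nat * node, exists q : node,
    [/\ ((val ip.2).1 < (val q).1)%N, lo ip.2 <= lo q, hi q <= hi ip.2 &
        forall t, F ip.1 t -> ~~ (lo q <= t <= hi q)].
  move=> [i p]; have [l [y [kl yl xy yw Fy]]] := avoid_node (Fb i) (valP p).
  by exists (exist _ (l, y) yl).
have p0P : 0 \in nodes 0 by rewrite inE.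
pose p0 : node := exist _ (0%N, 0) p0P.
pose p := fix p n : node := if n is n'.+1 then nxt (n', p n') else p0.
have p_lo m n : (m <= n)%N -> lo (p m) <= lo (p n).
  apply: (homo_leq (r := fun a b => lo a <= lo b)) => [//|a b c|i]; first exact: le_trans.
  by have [] := nxtP (i, p i).
have p_hi m n : (m <= n)%N -> hi (p n) <= hi (p m).
  apply: (homo_leq (r := fun a b => hi b <= hi a)) => [//|a b c h1 h2|i].
    exact: le_trans h2 h1.
  by have [] := nxtP (i, p i).
have p_le m : (m <= (val (p m)).1)%N.
  by elim: m => // m IH; apply: leq_ltn_trans IH _; have [] := nxtP (m, p m).
have lo_hi m n : lo (p m) <= hi (p n).
  apply: le_trans (p_lo _ _ (leq_maxl m n)) _; apply: le_trans (p_hi _ _ (leq_maxr m n)).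
  by rewrite lerDl ltW // width_gt0.
(* By [lo_hi] this supremum lies in every chosen piece. *)
pose x := sup (range (lo \o p)).
have x_lo n : lo (p n) <= x.
  by apply: ub_le_sup; [exists (hi (p 0%N)) => _ [m _ <-]; exact: lo_hi|exists n].
have x_hi n : x <= hi (p n).
  by apply: ge_sup; [exists (lo (p 0%N)), 0%N|move=> _ [m _ <-]; exact: lo_hi].
have Cx : cantor x.
  move=> k; apply: nodes_restrict (p_le k) _; exists (lo (p k)); first exact: (valP (p k)).
  by rewrite x_lo; exact: x_hi.
have [i _ Fx] := cF _ Cx.
have [_ _ _ /(_ _ Fx)] := nxtP (i, p i).
(* The piece [p i.+1] was chosen to avoid [F i]. *)
by rewrite (x_lo i.+1) (x_hi i.+1).
Qed.


End CantorSet.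

Theorem theorem1p16 (R : realType) (beta : R) :
  0 < beta < 1 ->
  exists A : set R,
    compact A /\ A `<=` `[0, 1]%classic /\ packing_dim A = beta%:E /\
    forall (d : nat) (alpha : R) (f : R -> 'rV[R]_d),
      (0 < d)%N -> 0 < alpha < 1 -> holder_on A f alpha ->
      (packing_dim (graph_of A f) <=
        (Num.max (beta * d%:R / (alpha * d%:R + beta * (1 - alpha * d%:R)))
                 (beta * (d%:R + 1 - alpha * d%:R)))%:E)%E.
Proof.
move=> beta01; exists (cantor beta); split; first exact: cantor_compact.
split; first exact: cantor_sub.
split=> [|d alpha f]; last exact: packing_dim_graph_le.
apply/eqP; rewrite eq_le packing_dim_cantor_ge // andbT.
exact: le_trans (packing_dim_le_upper_box_dim _) (upper_box_dim_cantor beta01).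
Qed.
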